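(* Let $\alpha:\mathbb{C}^2\to\mathbb{R}\times\mathbb{C}=\mathbb{R}^3$ be given by $\alpha(u,v)=\left(\frac{|u|^2}{1+|u|^2+|v|^2},\frac{\bar{u}v}{1+|u|^2+|v|^2}\right)$, and let $B\subset\mathbb{R}^3$ be the open ball of radius $\frac12$ centered at $(\frac12,0,0)$. Let $(u,v)\in\mathbb{C}^*\times\mathbb{C}$ and write $\alpha(u,v)=(x,y,z)$. Then $\alpha(\mathbb{C}^*\times\mathbb{C})\subset B$ and $$|u|^2+|v|^2=\frac{x^2+y^2+z^2}{x-x^2-y^2-z^2}.$$
   Context: $\mathbb{R}^3$ is identified with $\mathbb{R}\times\mathbb{C}$ by $(x,y,z)\mapsto(x,y+iz)$. $\mathbb{C}^*=\mathbb{C}\setminus\{0\}$. *)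

(* Defs.v *)
From Stdlib Require Import Reals.
From Coquelicot Require Import Coquelicot.
Open Scope R_scope.

Definition R3 : Type := (R * R * R)%type.

Definition R3_to_RC (p : R3) : R * C :=
  let '(x, y, z) := p in (x, Cplus (RtoC y) (Cmult Ci (RtoC z))).

Definition RC_to_R3 (q : R * C) : R3 :=
  let '(t, w) := q in (t, Re w, Im w).

Lemma R3_to_RC_K (p : R3) : RC_to_R3 (R3_to_RC p) = p.
Proof.
  destruct p as [[x y] z]; unfold RC_to_R3, R3_to_RC, Re, Im; simpl.
  repeat f_equal; ring.
Qed.

Lemma RC_to_R3_K (q : R * C) : R3_to_RC (RC_to_R3 q) = q.
Proof.
  destruct q as [t [a b]]; unfold RC_to_R3, R3_to_RC, Re, Im,
    Cplus, Cmult, RtoC, Ci; simpl.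
  repeat f_equal; ring.
Qed.

Definition alpha_RC (p : C * C) : R * C :=
  let '(u, v) := p in
  (Cmod u ^ 2 / (1 + Cmod u ^ 2 + Cmod v ^ 2),
   Cdiv (Cmult (Cconj u) v) (RtoC (1 + Cmod u ^ 2 + Cmod v ^ 2))).

Definition alpha (p : C * C) : R3 := RC_to_R3 (alpha_RC p).

(* The metric that Coquelicot puts on products is the sup one, so its [ball]
   on [R * R * R] is a cube; the Euclidean distance is needed here. *)
Definition dist3 (p q : R3) : R :=
  let '(x, y, z) := p in
  let '(a, b, c) := q in
  sqrt ((x - a) ^ 2 + (y - b) ^ 2 + (z - c) ^ 2).

Definition open_ball3 (c : R3) (r : R) : R3 -> Prop := fun p => dist3 p c < r.

Definition B : R3 -> Prop := open_ball3 (1 / 2, 0, 0) (1 / 2).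

Definition Cstar : C -> Prop := fun u => u <> RtoC 0.

(* Main.v *)
(** Write [p = |u|^2], [q = |v|^2] and [D = 1 + p + q].  Since
    [|conj u * v|^2 = p q], the point [(x, y, z) = alpha (u, v)] satisfies
    [x^2 + y^2 + z^2 = p (p + q) / D^2] and [x - (x^2 + y^2 + z^2) = p / D^2].
    The second quantity is positive exactly when [(x, y, z)] lies in [B], and
    the quotient of the two is [p + q]. *)
Require Import Defs.
From Stdlib Require Import Reals Lra.
From Coquelicot Require Import Coquelicot.
Open Scope R_scope.

Lemma Cmod_sqr (w : C) : Cmod w ^ 2 = Re w ^ 2 + Im w ^ 2.
Proof. unfold Cmod; apply pow2_sqrt; nra. Qed.

Lemma Cmod_sqr_pos (u : C) : Cstar u -> 0 < Cmod u ^ 2.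
Proof. intros Hu; apply pow_lt; now apply Cmod_gt_0. Qed.

Lemma alpha_norm_sqr (u v : C) (x y z : R) :
  alpha (u, v) = (x, y, z) ->
  x ^ 2 + y ^ 2 + z ^ 2 =
    Cmod u ^ 2 * (Cmod u ^ 2 + Cmod v ^ 2) /
      (1 + Cmod u ^ 2 + Cmod v ^ 2) ^ 2.
Proof.
  unfold alpha, alpha_RC, RC_to_R3; intros H.
  assert (HD : 0 < 1 + Cmod u ^ 2 + Cmod v ^ 2)
    by (pose proof (pow2_ge_0 (Cmod u)); pose proof (pow2_ge_0 (Cmod v)); lra).
  apply pair_equal_spec in H as [[<- <-]%pair_equal_spec <-].
  (* Folding [y ^ 2 + z ^ 2] back into the squared modulus of the complex coordinate lets
     multiplicativity of [Cmod] replace an expansion into real and imaginary parts. *)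
  rewrite Rplus_assoc, <- Cmod_sqr, Cmod_div, Cmod_mult, Cmod_conj, Cmod_R,
    Rabs_pos_eq by (try intros E%RtoC_inj; lra).
  field; lra.
Qed.

Lemma alpha_x_sub_norm_sqr (u v : C) (x y z : R) :
  alpha (u, v) = (x, y, z) ->
  x - (x ^ 2 + y ^ 2 + z ^ 2) =
    Cmod u ^ 2 / (1 + Cmod u ^ 2 + Cmod v ^ 2) ^ 2.
Proof.
  intros H; rewrite (alpha_norm_sqr _ _ _ _ _ H).
  unfold alpha, alpha_RC, RC_to_R3 in H; injection H as <- _ _.
  field; pose proof (pow2_ge_0 (Cmod u)); pose proof (pow2_ge_0 (Cmod v)); lra.
Qed.

(** The sphere bounding [B] passes through the origin, so the constant 1/4 cancels when the squared
    distance to the centre is expanded. *)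
Lemma B_iff (x y z : R) : B (x, y, z) <-> 0 < x - (x ^ 2 + y ^ 2 + z ^ 2).
Proof.
  unfold B, open_ball3, dist3.
  (* The second occurrence is the radius; the first is the centre's coordinate. *)
  replace (1 / 2) with (sqrt ((1 / 2) ^ 2)) at 2 by (apply sqrt_pow2; lra).
  split; intros H.
  - apply sqrt_lt_0_alt in H; lra.
  - apply sqrt_lt_1_alt; split; [| lra].
    repeat apply Rplus_le_le_0_compat; apply pow2_ge_0.
Qed.

Theorem lemma2p1 :
  (forall u v : C, Cstar u -> B (alpha (u, v))) /\
  (forall (u v : C) (x y z : R),
     Cstar u ->
     alpha (u, v) = (x, y, z) ->
     Cmod u ^ 2 + Cmod v ^ 2 =
       (x ^ 2 + y ^ 2 + z ^ 2) / (x - x ^ 2 - y ^ 2 - z ^ 2)).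
Proof.
  split.
  - intros u v Hu; apply Cmod_sqr_pos in Hu.
    destruct (alpha (u, v)) as [[x y] z] eqn:H.
    apply B_iff; rewrite (alpha_x_sub_norm_sqr _ _ _ _ _ H).
    apply Rdiv_lt_0_compat; [assumption | apply pow_lt].
    pose proof (pow2_ge_0 (Cmod v)); lra.
  - intros u v x y z Hu H; apply Cmod_sqr_pos in Hu.
    replace (x - x ^ 2 - y ^ 2 - z ^ 2)
      with (x - (x ^ 2 + y ^ 2 + z ^ 2)) by ring.
    rewrite (alpha_x_sub_norm_sqr _ _ _ _ _ H), (alpha_norm_sqr _ _ _ _ _ H).
    pose proof (pow2_ge_0 (Cmod v)).
    (* Cancelling the common factor [p / D^2] uses that [u] is nonzero. *)
    field; split; [lra | intros E; rewrite E in Hu; lra].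
Qed.
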